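(* Let $(\mathcal{A},\varphi)$ be an algebraic probability space, $r\ge1$ and $X=(X_1,\dots,X_r)$ with $X_i\in\mathcal{A}$. With $M_X(t)$, $K_X^M$, $\mu_X(t)$, $\kappa_X$ as defined in the context, the following hold for all $t,s\in\mathbb{R}$. (1) $\mu_X(t+s)=\mu_X(t)\circ\mu_X(s)$. (2) $\dfrac{\partial M_X(t)}{\partial t}=M_X(t)\,K_X^M\big(z_1M_X(t),\dots,z_rM_X(t)\big)$, or equivalently, $\dfrac{\partial\mu_X(t)}{\partial t}=\kappa_X(\mu_X(t))$.
   Context: An algebraic probability space $(\mathcal{A},\varphi)$ is a unital $*$-algebra $\mathcal{A}$ over $\mathbb{C}$ with a state $\varphi$. **Monotone independence.** Let $\Lambda$ be linearly ordered by $<$. $*$-subalgebras $\{\mathcal{A}_\lambda\}_{\lambda\in\Lambda}$ are monotone independent if for all $n\ge2$, $X_i\in\mathcal{A}_{\lambda_i}$ with $\lambda_i\neq\lambda_{i+1}$ ($1\le i\le n-1$), one has $\varphi(X_1\cdots X_i\cdots X_n)=\varphi(X_i)\varphi(X_1\cdots X_{i-1}X_{i+1}\cdots X_n)$ whenever $\lambda_{i-1}<\lambda_i$ and $\lambda_i>\lambda_{i+1}$ (one of the inequalities is dropped when $i=1$ or $i=n$). **Dot operation.** Take copies $\{X^{(j)}\}_{j\ge1}$ of every $X\in\mathcal{A}$ in an algebraic probability space $(\widetilde{\mathcal{A}},\widetilde\varphi)$ such that: $X\mapsto X^{(j)}$ is a (not necessarily unital) $*$-homomorphism $\mathcal{A}\to\widetilde{\mathcal{A}}$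 for each $j$; $\widetilde\varphi(X_1^{(j)}\cdots X_n^{(j)})=\varphi(X_1\cdots X_n)$ for all $X_i\in\mathcal{A}$, $j,n\ge1$; and the subalgebras $\mathcal{A}^{(j)}=\{X^{(j)}\}_{X\in\mathcal{A}}$, $j\ge1$, are monotone independent (natural order on indices). Such copies exist. Put $N.X=X^{(1)}+\cdots+X^{(N)}$, $0.X=0$, and write $\varphi$ for $\widetilde\varphi$. **The functionals $\varphi_t$ and cumulants.** $\varphi_N(X_1,\dots,X_n):=\varphi(N.X_1\cdots N.X_n)$ is a polynomial in $N$ without constant term; replacing $N\in\mathbb{N}$ by $t\in\mathbb{R}$ in this polynomial defines the multilinear functionals $\varphi_t:\mathcal{A}^n\to\mathbb{C}$. The monotone cumulant $K_n^M(X_1,\dots,X_n)$ is the coefficient of $N$ (linear coefficient) in this polynomial. **Generating functions.** $\mathbb{C}[[z_1,\dots,z_r]]$ is the ring of formal power series in non-commutative generators. Put $$M_X(t)=M_X(t;z_1,\dots,z_r):=1+\sum_{n\ge1}\sum_{i_1,\dots,i_n=1}^r\varphi_t(X_{i_1},\dots,X_{i_n})z_{i_1}\cdots z_{i_n},$$ $$K_X^M(z_1,\dots,z_r):=\sum_{n\ge1}\sum_{i_1,\dots,i_n=1}^rK_n^M(X_{i_1},\dots,X_{i_n})z_{i_1}\cdots z_{i_n}.$$ Let $\mu_{X,i}(t):=z_iM_X(t)$, $\kappa_{X,i}(z_1,\dots,z_r):=z_iK_X^M(z_1,\dots,z_r)$, $\mu_X(t):=(\mu_{X,1}(t),\dots,\mu_{X,r}(t))$,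 $\kappa_X:=(\kappa_{X,1},\dots,\kappa_{X,r})$. For vectors of series $F=(F_1,\dots,F_r)$ and $G=(G_1,\dots,G_r)$ with the $G_i$ having zero constant term, $F\circ G=F(G)$ is the vector with components $F_i(G_1,\dots,G_r)$ (substitution of $G_j$ for $z_j$, preserving the order of factors). Derivatives in $t$ are taken coefficientwise. *)

(* Defs.v *)
From HB Require Import structures.
From mathcomp Require Import all_boot all_order all_algebra.
From mathcomp Require Import all_classical all_reals all_analysis.
From mathcomp Require Import complex.

Set Implicit Arguments.
Unset Strict Implicit.
Unset Printing Implicit Defensive.

Import Order.TTheory GRing.Theory Num.Theory.
Import numFieldNormedType.Exports.

Local Open Scope classical_set_scope.
Local Open Scope ring_scope.

HB.mixin Record isStarAlgebra (C : numClosedFieldType) A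
    of GRing.Algebra C A := {
  star : A -> A;
  starK : involutive star;
  starD : {morph star : x y / x + y};
  starZ : forall (c : C) (x : A), star (c *: x) = c^* *: star x;
  starM : forall x y : A, star (x * y) = star y * star x
}.

#[short(type="starAlgType")]
HB.structure Definition StarAlgebra (C : numClosedFieldType) :=
  {A of GRing.Algebra C A & isStarAlgebra C A}.

(* In a numClosedFieldType, [0 <= z] says that z is real and nonnegative. *)
Record state (C : numClosedFieldType) (A : starAlgType C) := State {
  state_fun :> {scalar A};
  state1 : state_fun 1 = 1;
  state_ge0 : forall x : A, 0 <= state_fun (star x * x)
}.

(* Unitality is not required. *)
Record star_hom (C : numClosedFieldType) (A B : starAlgType C) (f : A -> B)
    : Prop := StarHom {
  star_homD : {morph f : x y / x + y};
  star_homZ : forall (c : C) (x : A), f (c *: x) = c *: f x;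
  star_homM : {morph f : x y / x * y};
  star_homS : {morph f : x / star x}
}.

(* Only the values of [l] and [X] at the positions 0, ..., n - 1 matter. *)
Definition monotone_independent (C : numClosedFieldType) (A : starAlgType C)
    (phi : state A) (d : Order.disp_t) (L : orderType d) (S : L -> set A)
    : Prop :=
  forall (n : nat) (l : nat -> L) (X : nat -> A),
    (2 <= n)%N ->
    (forall i, (i < n)%N -> S (l i) (X i)) ->
    (forall i, (i.+1 < n)%N -> l i != l i.+1) ->
    forall i, (i < n)%N ->
      ((0 < i)%N -> (l i.-1 < l i)%O) ->
      ((i.+1 < n)%N -> (l i.+1 < l i)%O) ->
      phi (\prod_(j < n) X j) =
        phi (X i) * phi (\prod_(j < n | j != i :> nat) X j).

(* [copy j X] stands for X^(j+1): the copies are numbered from 0. *)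
Record monotone_copies (C : numClosedFieldType) (A B : starAlgType C)
    (phi : state A) (psi : state B) (copy : nat -> A -> B) : Prop :=
  MonotoneCopies {
  copy_hom : forall j, star_hom (copy j);
  copy_state : forall j (s : seq A), s != [::] ->
    psi (\prod_(x <- s) copy j x) = phi (\prod_(x <- s) x);
  copy_indep : monotone_independent psi (fun j => range (copy j))
}.

Definition dot (C : numClosedFieldType) (A B : starAlgType C)
    (copy : nat -> A -> B) (N : nat) (x : A) : B :=
  \sum_(j < N) copy j x.

(* The polynomial P with P(N) = phi_N(x_1, ..., x_n) for every natural number
   N, where s = [:: x_1; ...; x_n]. At most one polynomial has this property;
   the default value 0 would only be taken if there were none. *)
Definition moment_poly (C : numClosedFieldType) (A B : starAlgType C)
    (psi : state B) (copy : nat -> A -> B) (s : seq A) : {poly C} :=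
  xget 0 [set P : {poly C} |
    forall N : nat, P.[N%:R] = psi (\prod_(x <- s) dot copy N x)].

Definition moment (R : realType) (A B : starAlgType R[i])
    (psi : state B) (copy : nat -> A -> B) (t : R) (s : seq A) : R[i] :=
  (moment_poly psi copy s).[(t%:C)%C].

Definition cumulant (C : numClosedFieldType) (A B : starAlgType C)
    (psi : state B) (copy : nat -> A -> B) (s : seq A) : C :=
  (moment_poly psi copy s)`_1.

(* A series is the family of its coefficients; the word [:: i_1; ...; i_n]
   stands for the monomial z_{i_1} ... z_{i_n}. *)
Definition ncseries (K : comNzRingType) (r : nat) : Type := seq 'I_r -> K.

HB.instance Definition _ (K : comNzRingType) (r : nat) :=
  GRing.Zmodule.copy (ncseries K r) (seq 'I_r -> K).

Section NCSeriesRing.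
Variables (K : comNzRingType) (r : nat).
Implicit Types F G H : ncseries K r.

Definition ncseries_one : ncseries K r := fun w => (w == [::])%:R.

Definition ncseries_mul F G : ncseries K r := fun w =>
  \sum_(k < (size w).+1) F (take k w) * G (drop k w).

Let shift F (a : 'I_r) : ncseries K r := fun w => F (a :: w).

Let mulnil F G : ncseries_mul F G [::] = F [::] * G [::].
Proof. by rewrite /ncseries_mul big_ord1. Qed.

Let mulcons F G a w : ncseries_mul F G (a :: w) =
  F [::] * G (a :: w) + ncseries_mul (shift F a) G w.
Proof. by rewrite /ncseries_mul /= big_ord_recl /=. Qed.

Let addE F G w : (F + G) w = F w + G w.
Proof. by []. Qed.

Let mulDl : left_distributive ncseries_mul +%R.
Proof.
move=> F G H; apply/funext => w; rewrite addE /ncseries_mul -big_split /=.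
by apply: eq_bigr => k _; rewrite addE mulrDl.
Qed.

Let mulDr : right_distributive ncseries_mul +%R.
Proof.
move=> F G H; apply/funext => w; rewrite addE /ncseries_mul -big_split /=.
by apply: eq_bigr => k _; rewrite addE mulrDr.
Qed.

Let mulZ (c : K) F G w :
  ncseries_mul ((fun v => c * F v) : ncseries K r) G w =
  c * ncseries_mul F G w.
Proof.
by rewrite /ncseries_mul big_distrr /=; apply: eq_bigr => k _; rewrite mulrA.
Qed.

Let mulA : associative ncseries_mul.
Proof.
move=> F G H; apply/funext => w; elim: w F G H => [|a w IH] F G H.
  by rewrite !mulnil mulrA.
have -> : ncseries_mul (ncseries_mul F G) H (a :: w) =
    ncseries_mul F G [::] * H (a :: w) +
    ncseries_mul (((fun v => F [::] * shift G a v) : ncseries K r) +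
                  ncseries_mul (shift F a) G) H w.
  rewrite mulcons; congr (_ + ncseries_mul _ _ _).
  by apply/funext => v; rewrite {1}/shift mulcons.
by rewrite mulDl addE mulZ -IH !mulcons mulnil mulrDr -!mulrA addrA.
Qed.

Let mul1 : left_id ncseries_one ncseries_mul.
Proof.
move=> F; apply/funext => w.
rewrite /ncseries_mul big_ord_recl /= take0 drop0 /ncseries_one eqxx mul1r.
rewrite big1 ?addr0// => k _; rewrite -size_eq0 size_take /=.
by case: w k => [|a w] [k] //= _; case: ifP; rewrite mul0r.
Qed.

Let mulr_1 : right_id ncseries_one ncseries_mul.
Proof.
move=> F; apply/funext => w.
rewrite /ncseries_mul big_ord_recr /= take_size drop_size /ncseries_one eqxx.
rewrite mulr1 big1 ?add0r// => k _.
by rewrite -size_eq0 size_drop subn_eq0 leqNgt ltn_ord mulr0.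
Qed.

Let one_neq0 : ncseries_one != 0.
Proof.
apply/eqP => /(congr1 (fun F : ncseries K r => F [::])) /eqP.
by rewrite /ncseries_one eqxx oner_eq0.
Qed.

HB.instance Definition _ := GRing.Zmodule_isNzRing.Build (ncseries K r)
  mulA mul1 mulr_1 mulDl mulDr one_neq0.

End NCSeriesRing.

Definition ncvar (K : comNzRingType) (r : nat) (i : 'I_r) : ncseries K r :=
  fun w => (w == [:: i])%:R.

(* F(G_1, ..., G_r), meaningful when the G_i have zero constant term: a product
   of n of them then has no monomial of length < n, so that the coefficient at
   w of the infinite sum only receives contributions from words v of length
   n <= size w. *)
Definition ncsubst (K : comNzRingType) (r : nat)
    (F : ncseries K r) (G : 'I_r -> ncseries K r) : ncseries K r :=
  fun w => \sum_(n < (size w).+1) \sum_(v : n.-tuple 'I_r)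
    F v * (\prod_(i <- v) G i : ncseries K r) w.

Definition nccomp (K : comNzRingType) (r : nat)
    (F G : 'I_r -> ncseries K r) : 'I_r -> ncseries K r :=
  fun i => ncsubst (F i) G.

Definition is_cderive (R : realType) (t : R) (f : R -> R[i]) (l : R[i])
    : Prop :=
  is_derive t 1 (fun u => complex.Re (f u)) (complex.Re l) /\
  is_derive t 1 (fun u => complex.Im (f u)) (complex.Im l).

Definition is_ncderive (R : realType) (r : nat) (t : R)
    (F : R -> ncseries R[i] r) (G : ncseries R[i] r) : Prop :=
  forall w, is_cderive t (fun u => F u w) (G w).

Section GeneratingFunctions.
Variables (R : realType) (A B : starAlgType R[i]) (psi : state B).
Variables (copy : nat -> A -> B) (r : nat) (X : 'I_r -> A).

Definition M_series (t : R) : ncseries R[i] r := fun w =>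
  if w is [::] then 1 else moment psi copy t [seq X i | i <- w].

Definition K_series : ncseries R[i] r := fun w =>
  if w is [::] then 0 else cumulant psi copy [seq X i | i <- w].

Definition mu_vec (t : R) : 'I_r -> ncseries R[i] r :=
  fun i => ncvar _ i * M_series t.

Definition kappa_vec : 'I_r -> ncseries R[i] r :=
  fun i => ncvar _ i * K_series.

End GeneratingFunctions.

(* Main.v *)
(* Write T_Z F for F(z_1 Z, ..., z_r Z). In X^(1) + ... + X^(N+1), every maximal
   run of factors from the last copy is a peak, so monotone independence gives
   M(N+1) = M(1) T_{M(1)} M(N). As T_Z is multiplicative and
   T_Z T_Z' = T_{Z T_Z Z'}, induction yields M(N+N') = M(N') T_{M(N')} M(N) for
   natural numbers. The coefficients of M(N) are polynomials in N, so this
   identity extends to real arguments; this is (1), and comparing the linear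
   coefficients in the first argument gives (2). *)

Require Import Defs.
From mathcomp Require Import all_boot all_order all_algebra.
From mathcomp Require Import all_classical all_reals all_analysis.
From mathcomp Require Import complex.

Set Implicit Arguments.
Unset Strict Implicit.
Unset Printing Implicit Defensive.

Import Order.TTheory GRing.Theory Num.Theory.
Local Open Scope ring_scope.

(** * Substitution of [z_i Z] for [z_i] in non-commutative series *)

Section Substitution.
Variables (K : comNzRingType) (r : nat).
Implicit Types (F G H Z : ncseries K r) (w : seq 'I_r) (a b : 'I_r).

(** The left derivative by [z_a]. A series is determined by its constant term and its left
    derivatives, which is how the identities below are proved. *)
Definition ncshift a F : ncseries K r := fun w => F (a :: w).

Lemma ncmulE F G w :
  (F * G) w = \sum_(k < (size w).+1) F (take k w) * G (drop k w).
Proof. by []. Qed.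

Lemma ncmul_nil F G : (F * G) [::] = F [::] * G [::].
Proof. by rewrite ncmulE big_ord1. Qed.

Lemma ncmul_cons F G a w :
  (F * G) (a :: w) = F [::] * G (a :: w) + (ncshift a F * G) w.
Proof. by rewrite ncmulE /= big_ord_recl. Qed.

Lemma eq_ncmulr F G H w :
  (forall u, (size u <= size w)%N -> G u = H u) -> (F * G) w = (F * H) w.
Proof.
move=> GH; rewrite !ncmulE; apply: eq_bigr => k _.
by rewrite GH// size_drop leq_subr.
Qed.

Lemma ncshiftM a F G :
  ncshift a (F * G) = fun w => F [::] * ncshift a G w + (ncshift a F * G) w.
Proof. by apply/funext => w; exact: ncmul_cons. Qed.

Lemma ncvarM_nil b F : (ncvar K b * F) [::] = 0.
Proof. by rewrite ncmul_nil mul0r. Qed.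

Lemma ncvarM_cons b F a w : (ncvar K b * F) (a :: w) = (a == b)%:R * F w.
Proof.
rewrite ncmul_cons mul0r add0r ncmulE big_ord_recl take0 drop0.
rewrite big1 ?addr0 /ncshift/ncvar => [|k _]; first by rewrite eqseq_cons andbT.
case: w k => [[]//|b' w k]; by rewrite /= eqseq_cons andbF mul0r.
Qed.

(** This is [T_Z F]. *)
Definition ncvsubst Z F : ncseries K r := ncsubst F (fun i => ncvar K i * Z).

(** Each factor [z_i Z] has zero constant term. *)
Lemma ncvprod_small Z (s : seq 'I_r) w : (size w < size s)%N ->
  (\prod_(i <- s) (ncvar K i * Z) : ncseries K r) w = 0.
Proof.
elim: s w => [//|b s IH] [|a w] /= ws; rewrite big_cons -mulrA.
  by rewrite ncvarM_nil.
rewrite ncvarM_cons ncmulE big1 ?mulr0// => k _.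
by rewrite IH ?mulr0// size_drop (leq_ltn_trans (leq_subr _ _)).
Qed.

Lemma ncvsubst_widen Z F w m : (size w <= m)%N ->
  ncvsubst Z F w = \sum_(n < m.+1) \sum_(v : n.-tuple 'I_r)
    F v * (\prod_(i <- v) (ncvar K i * Z) : ncseries K r) w.
Proof.
rewrite -ltnS => wm; rewrite /ncvsubst/ncsubst.
rewrite (big_ord_widen _ (fun n => \sum_(v : n.-tuple 'I_r)
    F v * (\prod_(i <- v) (ncvar K i * Z) : ncseries K r) w) wm).
rewrite [RHS](bigID (fun n : 'I_m.+1 => (n < (size w).+1)%N)) /=.
rewrite [X in _ + X]big1 ?addr0// => n; rewrite -leqNgt => wn.
by rewrite big1// => v _; rewrite ncvprod_small ?mulr0// size_tuple.
Qed.

Lemma ncvsubst_nil Z F : ncvsubst Z F [::] = F [::].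
Proof.
rewrite /ncvsubst/ncsubst big_ord1 (big_pred1 [tuple]) => [|v].
  by rewrite big_nil mulr1.
by rewrite [v]tuple0 /= eqxx.
Qed.

Lemma big_tuple_cons (n : nat) (f : seq 'I_r -> K) :
  \sum_(v : n.+1.-tuple 'I_r) f v = \sum_b \sum_(v : n.-tuple 'I_r) f (b :: v).
Proof.
rewrite pair_big /=.
rewrite (reindex (fun p : 'I_r * n.-tuple 'I_r => cons_tuple p.1 p.2)) //=.
exists (fun v : n.+1.-tuple 'I_r => (thead v, behead_tuple v)) => [[b v] _|v _].
  by congr pair; apply: val_inj.
by apply: val_inj; case/tupleP: v.
Qed.

(** Only the monomials of [F] that begin with [z_a] reach a word beginning with [a]. Once [z_a] is
    removed, its factor [Z] is left in front of the rest of the substitution. This recursion on the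
    first letter replaces the explicit double sum from here on. *)
Lemma ncvsubst_cons Z F a w :
  ncvsubst Z F (a :: w) = (Z * ncvsubst Z (ncshift a F)) w.
Proof.
rewrite {1}/ncvsubst/ncsubst big_ord_recl big1 ?add0r => [|v _]; last first.
  by rewrite tuple0 big_nil mulr0.
transitivity (\sum_(n < (size w).+1) \sum_(v : n.-tuple 'I_r) F (a :: v) *
    (Z * \prod_(i <- v) (ncvar K i * Z)) w).
  apply: eq_bigr => n _.
  rewrite (big_tuple_cons n (fun v =>
    F v * (\prod_(i <- v) (ncvar K i * Z) : ncseries K r) (a :: w))).
  rewrite (bigD1 a)//= [X in _ + X]big1 ?addr0 => [|b ba].
    by apply: eq_bigr => v _; rewrite big_cons -mulrA ncvarM_cons eqxx mul1r.
  rewrite big1// => v _.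
  by rewrite big_cons -mulrA ncvarM_cons eq_sym (negPf ba) mul0r mulr0.
rewrite ncmulE; under eq_bigr => n _ do under eq_bigr => v _ do
  rewrite ncmulE mulr_sumr.
under eq_bigr => n _ do rewrite exchange_big.
rewrite exchange_big; apply: eq_bigr => k _ /=.
(* The inner substitution is evaluated at [drop k w]; its truncation is raised to [size w] so that
   the range no longer depends on [k]. *)
rewrite (@ncvsubst_widen _ _ _ (size w)) ?size_drop ?leq_subr// mulr_sumr.
apply: eq_bigr => n _; rewrite mulr_sumr; apply: eq_bigr => v _.
by rewrite mulrCA.
Qed.

Lemma ncshift_vsubst Z F a :
  ncshift a (ncvsubst Z F) = Z * ncvsubst Z (ncshift a F).
Proof. by apply/funext => w; exact: ncvsubst_cons. Qed.

Lemma ncvsubstDl_scale Z (c : K) F G w :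
  ncvsubst Z (fun v => c * F v + G v) w
  = c * ncvsubst Z F w + ncvsubst Z G w.
Proof.
rewrite /ncvsubst/ncsubst mulr_sumr -big_split; apply: eq_bigr => n _ /=.
rewrite mulr_sumr -big_split; apply: eq_bigr => v _ /=.
by rewrite mulrDl mulrA.
Qed.

Lemma ncvsubst0 Z : ncvsubst Z 0 = 0.
Proof.
apply/funext => w; rewrite /ncvsubst/ncsubst big1// => n _.
by rewrite big1// => v _; rewrite mul0r.
Qed.

Lemma ncvsubstB Z F G :
  ncvsubst Z (F - G) = ncvsubst Z F - ncvsubst Z G.
Proof.
apply/funext => w; have := ncvsubstDl_scale Z (-1) G F w.
rewrite mulN1r addrC => E.
rewrite -[RHS]/(ncvsubst Z F w - ncvsubst Z G w) -E; congr (ncvsubst Z _ w); apply/funext => v.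
by rewrite mulN1r addrC.
Qed.

Lemma ncshift_var (i a : 'I_r) F :
  ncshift a (ncvar K i * F) = if a == i then F else 0.
Proof.
apply/funext => w; rewrite /ncshift ncvarM_cons.
by case: eqP; rewrite ?mul1r ?mul0r.
Qed.

(** Translates between the equations for [M] and those for [mu]. *)
Lemma ncvsubst_varM (i : 'I_r) F Z :
  ncvsubst Z (ncvar K i * F) = ncvar K i * (Z * ncvsubst Z F).
Proof.
apply/funext => -[|a w]; first by rewrite ncvsubst_nil !ncvarM_nil.
rewrite ncvsubst_cons ncshift_var ncvarM_cons.
by case: eqP; rewrite ?mul1r// ncvsubst0 mulr0 mul0r.
Qed.

(** The product rule for [ncshift] matches the first-letter recursion. The induction is on the
    length of the word, because the factor [Z] in front evaluates the rest at arbitrary suffixes. *)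
Lemma ncvsubstM Z F G : ncvsubst Z (F * G) = ncvsubst Z F * ncvsubst Z G.
Proof.
apply/funext => w; have [n] := ubnP (size w).
elim: n w F G => [//|n IH] [|a w] F G /= wn.
  by rewrite ncvsubst_nil !ncmul_nil !ncvsubst_nil.
rewrite ncvsubst_cons ncmul_cons ncvsubst_nil ncshift_vsubst ncvsubst_cons.
rewrite -mulrA ncshiftM.
transitivity ((Z * (fun v => F [::] * ncvsubst Z (ncshift a G) v +
   ncvsubst Z (ncshift a F * G) v)) w).
  by apply: eq_ncmulr => u _; rewrite ncvsubstDl_scale.
transitivity ((Z * (fun v => F [::] * ncvsubst Z (ncshift a G) v +
   (ncvsubst Z (ncshift a F) * ncvsubst Z G) v)) w).
  by apply: eq_ncmulr => u uw; rewrite IH// (leq_ltn_trans uw).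
rewrite !ncmulE mulr_sumr -big_split; apply: eq_bigr => k _ /=.
by rewrite mulrDr mulrCA.
Qed.

Lemma ncvsubst_comp Z1 Z2 F :
  ncvsubst Z1 (ncvsubst Z2 F) = ncvsubst (Z1 * ncvsubst Z1 Z2) F.
Proof.
apply/funext => w; have [n] := ubnP (size w).
elim: n w F => [//|n IH] [|a w] F /= wn; first by rewrite !ncvsubst_nil.
rewrite !ncvsubst_cons ncshift_vsubst ncvsubstM mulrA.
by apply: eq_ncmulr => u uw; rewrite IH// (leq_ltn_trans uw).
Qed.

Lemma ncvsubst1 F : ncvsubst 1 F = F.
Proof.
apply/funext => w; elim: w F => [|a w IH] F; first by rewrite ncvsubst_nil.
by rewrite ncvsubst_cons mul1r IH.
Qed.

(** As [Z] has constant term 1, replacing [z_i] by [z_i Z] only adds terms of higher degree, so the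
    terms of lowest degree of [F] survive unchanged. *)
Lemma ncvsubst_lowest Z F w : Z [::] = 1 ->
  (forall u, (size u < size w)%N -> F u = 0) ->
  (Z * ncvsubst Z F) w = F w.
Proof.
move=> Z1; have [n] := ubnP (size w).
elim: n w F => [//|n IH] w F wn F0.
(* The first-letter recursion reduces this to the claim for [ncshift a F] at a shorter word. *)
have TF u : (size u <= size w)%N -> ncvsubst Z F u = F u.
  case: u => [|a u] uw; first by rewrite ncvsubst_nil.
  rewrite ncvsubst_cons IH ?(leq_trans uw)// => v vu.
  by apply: F0; rewrite (leq_trans _ uw).
rewrite ncmulE big_ord_recl take0 drop0 Z1 mul1r TF// big1 ?addr0// => k _.
have kw : (size (drop k.+1 w) < size w)%N.
  by rewrite size_drop ltn_subrL (leq_ltn_trans _ (ltn_ord k)).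
by rewrite TF ?(ltnW kw)// F0// mulr0.
Qed.

End Substitution.

(** * Change of coefficients *)

Definition ncmap (K K' : comNzRingType) (r : nat) (f : K -> K')
  (F : ncseries K r) : ncseries K' r := fun w => f (F w).

Section BaseChange.
Variables (K K' : comNzRingType) (r : nat).

Lemma ncmapM (f : {rmorphism K -> K'}) (F G : ncseries K r) :
  ncmap f (F * G) = ncmap f F * ncmap f G.
Proof.
apply/funext => w; rewrite /ncmap !ncmulE rmorph_sum.
by apply: eq_bigr => k _; rewrite rmorphM.
Qed.

Lemma ncmap_vsubst (f : {rmorphism K -> K'}) (Z F : ncseries K r) :
  ncmap f (ncvsubst Z F) = ncvsubst (ncmap f Z) (ncmap f F).
Proof.
apply/funext => w; have [n] := ubnP (size w).
elim: n w F => [//|n IH] [|a w] F /= wn.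
  by rewrite /ncmap !ncvsubst_nil.
rewrite [LHS]/ncmap !ncvsubst_cons -[LHS]/(ncmap f _ w) ncmapM.
by apply: eq_ncmulr => u uw; rewrite IH// (leq_ltn_trans uw).
Qed.

Variables (c : K -> K') (f : {additive K' -> K}).
Hypothesis fc : forall x y, f (c x * y) = x * f y.

Lemma ncmap_semilinM (Z : ncseries K r) (F : ncseries K' r) w :
  f ((ncmap c Z * F) w) = (Z * ncmap f F) w.
Proof. by rewrite !ncmulE raddf_sum; apply: eq_bigr => k _; rewrite fc. Qed.

(** Meant for [c] the constant polynomials and [f] the linear coefficient. The latter is not
    multiplicative, but [T_Z F] is linear in [F], and here [Z] has constant coefficients. *)
Lemma ncmap_semilin_vsubst (Z : ncseries K r) (F : ncseries K' r) w :
  f (ncvsubst (ncmap c Z) F w) = ncvsubst Z (ncmap f F) w.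
Proof.
have [n] := ubnP (size w); elim: n w F => [//|n IH] [|a w] F /= wn.
  by rewrite !ncvsubst_nil.
rewrite !ncvsubst_cons ncmap_semilinM; apply: eq_ncmulr => u uw.
by rewrite [LHS]IH// (leq_ltn_trans uw).
Qed.

End BaseChange.

(** * Peaks in words of copies *)

Section OneStep.
Variables (C : numClosedFieldType) (A B : starAlgType C).
Variables (phi : state A) (psi : state B) (copy : nat -> A -> B).
Hypothesis hcopy : monotone_copies phi psi copy.

Let copyM j : {morph copy j : x y / x * y}.
Proof. exact: star_homM (copy_hom hcopy j). Qed.

Lemma copy_prod j (s : seq A) : s != [::] ->
  \prod_(x <- s) copy j x = copy j (\prod_(x <- s) x).
Proof.
elim: s => [//|x [_|y s IH] _]; first by rewrite !big_seq1.
by rewrite big_cons [in RHS]big_cons copyM IH.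
Qed.

Let letter (p : nat * A) : B := copy p.1 p.2.

(* Monotone independence only speaks about words with distinct neighbours. *)
Lemma merge_letters (s : seq (nat * A)) : exists s' : seq (nat * A),
  [/\ \prod_(p <- s') letter p = \prod_(p <- s) letter p,
      sorted (fun p q => p.1 != q.1) s',
      take 1 (unzip1 s') = take 1 (unzip1 s) &
      {subset unzip1 s' <= unzip1 s}].
Proof.
elim: s => [|[i x] s [s' [s'E s's s'h s'sub]]]; first by exists [::].
have sub_i : {subset i :: unzip1 s' <= i :: unzip1 s}.
  by move=> j; rewrite !inE => /orP[->//|/s'sub ->]; rewrite orbT.
rewrite big_cons -s'E.
case: s' s's {s'E s'h s'sub} sub_i => [|[j y] s'] s's sub_i.
  by exists [:: (i, x)]; split; rewrite ?big_cons //= !take0.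
have [ij|ij] := eqVneq i j.
  exists ((i, x * y) :: s'); split => //=.
  - by rewrite !big_cons mulrA -ij /letter /= copyM.
  - by rewrite /= ij; case: (s') s's.
  - by rewrite !take0.
  - move=> k kk; apply: sub_i; move: kk.
    by rewrite !inE => /orP[->//|->]; rewrite !orbT.
exists [:: (i, x), (j, y) & s']; split => //=.
- by rewrite big_cons.
- by rewrite ij.
- by rewrite !take0.
Qed.

(** Merging equal neighbours on each side separately leaves [copy N y] between smaller neighbours,
    hence a peak. On the right only the first index is bounded: copy [N] may return later. *)
Lemma peak_letters N (s1 s2 : seq (nat * A)) (y : A) :
  all (fun j => j < N)%N (unzip1 s1) ->
  all (fun j => j < N)%N (take 1 (unzip1 s2)) ->
  psi (\prod_(p <- s1) letter p * copy N y * \prod_(p <- s2) letter p) =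
  phi y * psi (\prod_(p <- s1) letter p * \prod_(p <- s2) letter p).
Proof.
have psi_copy : psi (copy N y) = phi y.
  by have := copy_state hcopy N (isT : [:: y] != [::]); rewrite !big_seq1.
have [t1 [<- t1s _ t1sub]] := merge_letters s1.
have [t2 [<- t2s <- _]] := merge_letters s2.
move=> s1N; have {s1N t1sub} : all (fun j => j < N)%N (unzip1 t1).
  by apply/allP => j /t1sub /(allP s1N).
move=> t1N t2N.
(* Monotone independence requires at least two factors, so a lone [copy N y] is treated apart. *)
have [/andP[]|t12] := boolP (nilp t1 && nilp t2).
  move=> /nilP-> /nilP->.
  by rewrite !big_nil !mulr1 mul1r psi_copy state1 mulr1.
pose s := t1 ++ (N, y) :: t2; pose m := size t1.
have ss : sorted (fun p q => p.1 != q.1) s.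
  have t2s' : path (fun p q => p.1 != q.1) (N, y) t2.
    case: (t2) t2s t2N => [//|[j z] t] /= ->.
    by rewrite take0 !andbT eq_sym neq_ltn => ->.
  rewrite /s; case: (t1) t1s t1N => [//|p t] /= pt /(allP (s := _ :: _)) tN.
  rewrite cat_path pt /= t2s' andbT neq_ltn; apply/orP; left.
  by have /tN := mem_last p.1 (unzip1 t); rewrite last_map.
have sz : size s = (m + (size t2).+1)%N by rewrite size_cat.
have m_lt : (m < size s)%N by rewrite sz addnS ltnS leq_addr.
have nth_m : nth (N, y) s m = (N, y) by rewrite nth_cat ltnn subnn.
have nth_lt j : (j < m)%N -> nth (N, y) s j = nth (N, y) t1 j.
  by move=> jm; rewrite nth_cat jm.
have nth_gt j : nth (N, y) s (m + j.+1)%N = nth (N, y) t2 j.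
  by rewrite nth_cat ltnNge leq_addr /= addKn.
have := @copy_indep _ _ _ _ _ _ hcopy (size s)
  (fun j => (nth (N, y) s j).1) (fun j => letter (nth (N, y) s j)).
move=> /(_ _ _ _ m m_lt); rewrite nth_m /= psi_copy.
have -> : \prod_(j < size s) letter (nth (N, y) s j) =
    \prod_(p <- t1) letter p * copy N y * \prod_(p <- t2) letter p.
  rewrite -(big_mkord xpredT (fun j => letter (nth (N, y) s j))).
  by rewrite -(big_nth (N, y) xpredT letter) big_cat big_cons /= mulrA.
have -> : \prod_(j < size s | j != m :> nat) letter (nth (N, y) s j) =
    \prod_(p <- t1) letter p * \prod_(p <- t2) letter p.
  rewrite -(big_mkord (fun j => j != m) (fun j => letter (nth (N, y) s j))).
  rewrite (@big_cat_nat _ _ _ m) ?(ltnW m_lt)//=; congr (_ * _).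
    rewrite [RHS](big_nth (N, y)) big_nat_cond [RHS]big_nat_cond.
    apply: eq_big => j; first by case: ltngtP.
    by move=> /andP[/andP[_ jm] _]; rewrite nth_lt.
  rewrite big_ltn_cond// eqxx /= [RHS](big_nth (N, y)).
  have szE : size s = (size t2 + m.+1)%N by rewrite sz addnC addSnnS.
  rewrite -[m.+1]add0n szE big_addn addnK.
  rewrite big_nat_cond [RHS]big_nat_cond.
  apply: eq_big => j; last by rewrite addnC addSnnS nth_gt.
  by rewrite addnS gtn_eqF ?andbT// ltnS leq_addl.
(* What remains are the hypotheses of monotone independence: length, membership, distinct
   neighbours, and the two sides of the peak. *)
apply=> //.
- rewrite sz; move: t12; rewrite /nilp /m.
  by case: (size t1) (size t2) => [|?] [|?] //; rewrite addnS.
- by move=> j _; eexists.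
- by move=> j js; exact: (sortedP (N, y) ss).
- rewrite ltEnat /= => m0; rewrite nth_lt ?prednK//.
  by apply: (allP t1N _ _); rewrite map_f// mem_nth// prednK.
- rewrite ltEnat sz /= => t20.
  have := nth_gt 0; rewrite addn1 => ->.
  move: t20 t2N; rewrite addnS ltnS -addn1 leq_add2l.
  by case: (t2) => [//|p t] _ /=; rewrite take0 andbT.
Qed.


Lemma prod_dot_ind N (P : B -> Prop) (w : seq A) :
  P 0 -> (forall U V, P U -> P V -> P (U + V)) ->
  (forall s, all (fun j => j < N)%N (unzip1 s) -> P (\prod_(p <- s) letter p)) ->
  P (\prod_(x <- w) dot copy N x).
Proof.
(* The factors are expanded from left to right; [s] is the word of letters already chosen. *)
move=> P0 PD Ps; suff Pws s : all (fun j => j < N)%N (unzip1 s) ->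
    P (\prod_(p <- s) letter p * \prod_(x <- w) dot copy N x).
  by have := Pws [::] isT; rewrite big_nil mul1r.
elim: w s => [|x w IH] s sN; first by rewrite big_nil mulr1; exact: Ps.
rewrite big_cons mulrA /dot mulr_sumr mulr_suml.
apply: big_ind => // j _.
have := IH (rcons s (val j, x)); rewrite big_rcons /=; apply.
by rewrite /unzip1 map_rcons all_rcons /= ltn_ord.
Qed.

(** What may stand to the right of a peak. Being an equation linear in [V], it passes to sums of
    words. *)
Definition peakable N (V : B) := forall (s : seq (nat * A)) (y : A),
  all (fun j => j < N)%N (unzip1 s) ->
  psi (\prod_(p <- s) letter p * copy N y * V) =
  phi y * psi (\prod_(p <- s) letter p * V).

Lemma peakable1 N : peakable N 1.
Proof.
by move=> s y sN; have := @peak_letters N s [::] y sN isT; rewrite big_nil.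
Qed.

Lemma peakableD N U V : peakable N U -> peakable N V -> peakable N (U + V).
Proof. by move=> PU PV s y sN; rewrite !mulrDr !linearD /= mulrDr PU// PV. Qed.

Lemma peakable0 N : peakable N 0.
Proof. by move=> s y sN; rewrite !mulr0 linear0 mulr0. Qed.

(** Each term of the expanded first factor comes from a copy below [N], whatever follows it. *)
Lemma peakable_dot N (x : A) (w : seq A) :
  peakable N (dot copy N x * \prod_(z <- w) dot copy N.+1 z).
Proof.
rewrite /dot mulr_suml; apply: big_ind => [||j _]; first exact: peakable0.
  exact: peakableD.
apply: (@prod_dot_ind _ (fun V => peakable N (copy j x * V))) => [|U V|t _].
- by rewrite mulr0; exact: peakable0.
- by rewrite mulrDr; exact: peakableD.
- move=> s y sN; have := @peak_letters N s ((val j, x) :: t) y sN.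
  by rewrite /= take0 /= ltn_ord big_cons => /(_ isT).
Qed.

Lemma peak_dot N (V : B) (w : seq A) y : peakable N V ->
  psi (\prod_(x <- w) dot copy N x * copy N y * V) =
  phi y * psi (\prod_(x <- w) dot copy N x * V).
Proof.
move=> PV; apply: (@prod_dot_ind N (fun U =>
  psi (U * copy N y * V) = phi y * psi (U * V))) => [|U W|s sN].
- by rewrite !mul0r linear0 mulr0.
- by rewrite !mulrDl !linearD /= => -> ->; rewrite mulrDr.
- exact: PV.
Qed.

(** * The moment series at natural numbers and its recursion *)

Variables (r : nat) (X : 'I_r -> A).

Definition dot_series (N : nat) : ncseries C r :=
  fun w => psi (\prod_(i <- w) dot copy N (X i)).

Lemma dot_series_nil N : dot_series N [::] = 1.
Proof. by rewrite /dot_series big_nil state1. Qed.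

Lemma dot_series0 : dot_series 0 = 1.
Proof.
apply/funext => -[|a w]; first by rewrite dot_series_nil.
by rewrite /dot_series big_cons /dot big_ord0 mul0r linear0.
Qed.

Lemma dot_series1 h : h != [::] -> dot_series 1 h = phi (\prod_(i <- h) X i).
Proof.
move=> h0; have := copy_state hcopy 0 (s := map X h).
rewrite !big_map => <-; last by case: (h) h0.
by rewrite /dot_series; under eq_bigr do rewrite /dot big_ord1.
Qed.

(** A nonempty run from copy [N] multiplies to a single letter, which is a peak. The empty run is
    separate, since [copy N] may fail to preserve 1. *)
Lemma peak_run N V (u h : seq 'I_r) : peakable N V ->
  psi (\prod_(i <- u) dot copy N (X i) * \prod_(i <- h) copy N (X i) * V) =
  dot_series 1 h * psi (\prod_(i <- u) dot copy N (X i) * V).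
Proof.
move=> PV; have [->|h0] := eqVneq h [::].
  by rewrite dot_series_nil big_nil mulr1 mul1r.
rewrite dot_series1// -(big_map X xpredT (copy N)) copy_prod; last first.
  by case: (h) h0.
by rewrite big_map -(big_map X xpredT (dot copy N)) peak_dot.
Qed.

(** A scan from left to right: [u] holds the factors given to the first [N] copies, with finished
    runs already taken out, [h] the current run from copy [N], and [w] what is unread. The next
    letter either closes the run and joins [u], or extends [h]; these are the two terms of
    [ncmul_cons]. *)
Lemma dot_series_run N (w u h : seq 'I_r) :
  psi (\prod_(i <- u) dot copy N (X i) * \prod_(i <- h) copy N (X i) *
       \prod_(i <- w) dot copy N.+1 (X i)) =
  (((fun v => dot_series 1 (h ++ v)) : ncseries C r) *
   ncvsubst (dot_series 1) (fun v => dot_series N (u ++ v))) w.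
Proof.
elim: w u h => [|a w IH] u h.
  rewrite big_nil peak_run; last exact: peakable1.
  by rewrite ncmul_nil ncvsubst_nil !cats0 mulr1.
rewrite big_cons [dot copy N.+1 _]big_ord_recr /= -/(dot copy N (X a)).
rewrite mulrDl mulrDr linearD /= peak_run; last first.
  by have := @peakable_dot N (X a) (map X w); rewrite big_map.
rewrite ncmul_cons ncvsubst_cons cats0; congr (_ * _ + _).
  have := IH (rcons u a) [::]; rewrite big_nil mulr1 big_rcons /= mulrA => ->.
  congr ((_ * ncvsubst _ _) w).
  by apply/funext => v; rewrite /ncshift cat_rcons.
have := IH u (rcons h a); rewrite big_rcons /= !mulrA => ->.
by rewrite !ncmulE; apply: eq_bigr => k _; rewrite /ncshift cat_rcons.
Qed.

Lemma dot_seriesS N :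
  dot_series N.+1 = dot_series 1 * ncvsubst (dot_series 1) (dot_series N).
Proof.
apply/funext => w; have := dot_series_run N w [::] [::].
by rewrite !big_nil !mul1r.
Qed.

Lemma dot_seriesD N M :
  dot_series (N + M) = dot_series M * ncvsubst (dot_series M) (dot_series N).
Proof.
elim: M => [|M IH]; first by rewrite addn0 dot_series0 mul1r ncvsubst1.
by rewrite addnS dot_seriesS IH ncvsubstM mulrA ncvsubst_comp -dot_seriesS.
Qed.

End OneStep.

(** * Polynomials on the natural numbers and their indefinite sums *)

Lemma poly_nat_inj (C : numDomainType) (P Q : {poly C}) :
  (forall N, P.[N%:R] = Q.[N%:R]) -> P = Q.
Proof.
move=> PQ; apply/eqP; rewrite -subr_eq0; apply: contraT => PQ0.
have := max_poly_roots (rs := [seq i%:R | i <- iota 0 (size (P - Q))]) PQ0.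
rewrite size_map size_iota ltnn; apply.
  by apply/allP => _ /mapP[i _ ->]; rewrite /root !hornerE PQ subrr.
by rewrite map_inj_uniq ?iota_uniq// => i j /eqP; rewrite eqr_nat => /eqP.
Qed.

(** Summing the binomial expansion of [(j+1)^(n+1) - j^(n+1)] over [j < N] telescopes to [N^(n+1)].
    This is solved for the sum of the [j^n], whose coefficient [n+1] is invertible. *)
Lemma power_sum_poly (C : numFieldType) n : exists q : nat -> {poly C},
  forall i, (i < n)%N -> forall N, (q i).[N%:R] = \sum_(j < N) j%:R ^+ i.
Proof.
elim: n => [|n [q qE]]; first by exists (fun=> 0).
exists (fun i => if i == n then
   n.+1%:R^-1 *: ('X^(n.+1) - \sum_(k < n) 'C(n.+1, k)%:R *: q k) else q i).
move=> i; rewrite ltnS leq_eqVlt; case: eqVneq => [-> _ N|_ /= /qE//].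
rewrite hornerZ hornerD hornerN hornerXn horner_sum.
apply: (canLR (mulKf _)); first by rewrite pnatr_eq0.
have -> : N%:R ^+ n.+1 = \sum_(j < N) (j.+1%:R ^+ n.+1 - j%:R ^+ n.+1) :> C.
  rewrite -(big_mkord xpredT (fun j => j.+1%:R ^+ n.+1 - j%:R ^+ n.+1 : C)).
  by rewrite telescope_sumr// expr0n subr0.
under [X in _ - X]eq_bigr => k _ do rewrite hornerZ qE// mulr_sumr.
rewrite exchange_big -sumrB mulr_sumr; apply: eq_bigr => j _ /=.
have -> : j.+1%:R ^+ n.+1 =
    \sum_(k < n.+2) 'C(n.+1, k)%:R * j%:R ^+ k :> C.
  rewrite -nat1r exprDn; apply: eq_bigr => k _.
  by rewrite expr1n mul1r mulr_natl.
rewrite !big_ord_recr /= binn binSn mul1r addrK.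
by rewrite addrAC subrr add0r.
Qed.

Lemma sum_poly (C : numFieldType) (P : {poly C}) : exists Q : {poly C},
  forall N, Q.[N%:R] = \sum_(j < N) P.[j%:R].
Proof.
have [q qE] := power_sum_poly C (size P).
exists (\sum_(i < size P) P`_i *: q i) => N.
under [RHS]eq_bigr => j _ do rewrite horner_coef.
rewrite exchange_big horner_sum; apply: eq_bigr => i _.
by rewrite hornerZ qE// mulr_sumr.
Qed.

(** * Polynomiality in [N] and extension to arbitrary arguments *)

Section Polynomiality.
Variables (C : numClosedFieldType) (A B : starAlgType C).
Variables (phi : state A) (psi : state B) (copy : nat -> A -> B).
Hypothesis hcopy : monotone_copies phi psi copy.
Variables (r : nat) (X : 'I_r -> A).

Local Notation m := (dot_series psi copy X).

(** [M(t)] with [t] kept as a formal variable. *)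
Definition poly_series : ncseries {poly C} r :=
  fun w => moment_poly psi copy [seq X i | i <- w].

Definition nceval (t : C) := ncmap (r := r) (horner_eval t).

(** Once some polynomial takes the right values, [xget] does not fall back on its default. *)
Lemma poly_seriesP w : (exists P : {poly C}, forall N, P.[N%:R] = m N w) ->
  forall N, (poly_series w).[N%:R] = m N w.
Proof.
case=> P PE; rewrite /poly_series /moment_poly; case: xgetP => [Q _ QE N|].
  by rewrite QE big_map.
by move=> /(_ P); case=> N; rewrite big_map PE.
Qed.

(* The increment of N |-> m N w only involves the words shorter than w, so by
   induction m N w is an indefinite sum of a polynomial in N. *)
Lemma nceval_nat N : nceval N%:R poly_series = m N.
Proof.
apply/funext => w; move: N; have [n] := ubnP (size w).
elim: n w => [//|n IH] w wn N; apply: poly_seriesP.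
(* The expected increment. At this stage [poly_series] is known to be right only at words shorter
   than [w]; its value at [w] itself cancels in [D], by [ncvsubst_lowest]. *)
pose D := ((ncmap polyC (m 1) * ncvsubst (ncmap polyC (m 1)) poly_series) w
  - poly_series w).
have mS M : m M.+1 w - m M w = D.[M%:R].
  have evC : nceval M%:R (ncmap polyC (m 1)) = m 1.
    by apply/funext => u; rewrite /nceval /ncmap /horner_eval hornerC.
  have := @ncvsubst_lowest _ _ (m 1) (m M - nceval M%:R poly_series) w.
  rewrite ncvsubstB mulrBr -(dot_seriesS hcopy) dot_series_nil => /(_ erefl).
  have -> : m 1 * ncvsubst (m 1) (nceval M%:R poly_series) =
      nceval M%:R (ncmap polyC (m 1) *
                   ncvsubst (ncmap polyC (m 1)) poly_series).
    by rewrite /nceval ncmapM ncmap_vsubst -/(nceval _) evC.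
  move=> mM; set W := ncmap polyC _ * _ in mM.
  have E : m M.+1 w - (W w).[M%:R] = m M w - (poly_series w).[M%:R].
    apply: mM => u uw; apply/eqP; rewrite subr_eq0 eq_sym; apply/eqP.
    by apply: IH; rewrite (leq_trans uw).
  rewrite /D hornerD hornerN -[m M.+1 w](subrK (W w).[M%:R]) E.
  by rewrite addrC -addrA addKr addrC.
have [Q QE] := sum_poly D.
exists ((m 0 w)%:P + Q) => M; rewrite hornerD hornerC QE.
under eq_bigr => j _ do rewrite -mS.
rewrite -(big_mkord xpredT (fun j => m j.+1 w - m j w)) telescope_sumr//.
by rewrite addrC subrK.
Qed.

Lemma nceval_const (t : C) (F : ncseries C r) : nceval t (ncmap polyC F) = F.
Proof. by apply/funext => u; rewrite /nceval /ncmap /horner_eval hornerC. Qed.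

Lemma nceval_subst (t : C) (Z F : ncseries {poly C} r) :
  nceval t (Z * ncvsubst Z F) =
  nceval t Z * ncvsubst (nceval t Z) (nceval t F).
Proof. by rewrite /nceval ncmapM ncmap_vsubst. Qed.

(** With [N] fixed, both sides are polynomials in [s] that agree at natural numbers. *)
Lemma nceval_natD N (s : C) :
  nceval (N%:R + s) poly_series =
  nceval s poly_series * ncvsubst (nceval s poly_series) (m N).
Proof.
apply/funext => w.
have : poly_series w \Po ('X + N%:R%:P) =
    (poly_series * ncvsubst poly_series (ncmap polyC (m N))) w.
  apply: poly_nat_inj => M; rewrite horner_comp !hornerE -natrD addnC.
  rewrite -[LHS]/(nceval (N + M)%:R poly_series w).
  rewrite -[RHS]/(nceval M%:R (poly_series * _) w).
  by rewrite nceval_subst nceval_const !nceval_nat (dot_seriesD hcopy).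
move=> /(congr1 (horner_eval s)); rewrite {1}/horner_eval horner_comp !hornerE.
rewrite addrC => E; rewrite -[LHS]/((poly_series w).[_]) E.
rewrite -[LHS]/(nceval s (poly_series * _) w).
by rewrite nceval_subst nceval_const.
Qed.

(** Now [s] is fixed and the other argument is the variable. The result stays an identity of
    polynomials, so that its linear coefficient can be compared later. *)
Lemma poly_series_shift (s : C) w :
  poly_series w \Po ('X + s%:P) =
  (ncmap polyC (nceval s poly_series) *
   ncvsubst (ncmap polyC (nceval s poly_series)) poly_series) w.
Proof.
apply: poly_nat_inj => N; rewrite horner_comp !hornerE.
rewrite -[LHS]/(nceval (N%:R + s) poly_series w).
rewrite -[RHS]/(nceval N%:R (_ * _) w).
by rewrite nceval_subst nceval_const nceval_nat nceval_natD.
Qed.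

Lemma ncevalD (t s : C) :
  nceval (t + s) poly_series =
  nceval s poly_series * ncvsubst (nceval s poly_series) (nceval t poly_series).
Proof.
apply/funext => w.
have := congr1 (horner_eval t) (poly_series_shift s w).
rewrite {1}/horner_eval horner_comp !hornerE.
move=> E; rewrite -[LHS]/((poly_series w).[_]) E.
rewrite -[LHS]/(nceval t (_ * _) w).
by rewrite nceval_subst nceval_const.
Qed.

Lemma poly_series_generator (s : C) w :
  (poly_series w)^`().[s] =
  (nceval s poly_series *
   ncvsubst (nceval s poly_series) (fun v => (poly_series v)`_1)) w.
Proof.
have := congr1 (coefp 1) (poly_series_shift s w).
have fc (x : C) (y : {poly C}) : coefp 1 (x%:P * y) = x * coefp 1 y.
  by rewrite /= coefCM.
rewrite (ncmap_semilinM fc) /=.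
have -> : ncmap (coefp 1) (ncvsubst (ncmap polyC (nceval s poly_series))
      poly_series) =
    ncvsubst (nceval s poly_series) (fun v => (poly_series v)`_1).
  by apply/funext => v; rewrite -(ncmap_semilin_vsubst fc).
move=> <-; set P := _ \Po _.
(* The linear coefficient is the derivative at 0; the chain rule moves it to [s]. *)
have -> : P`_1 = P^`().[0] by rewrite horner_coef0 coef_deriv.
by rewrite deriv_comp hornerM horner_comp !hornerE derivD derivX derivC !hornerE.
Qed.

(** Matches the values 1 and 0 that [M_series] and [K_series] take at the empty word by
    definition. *)
Lemma poly_series_nil : poly_series [::] = 1.
Proof.
apply: poly_nat_inj => N; rewrite -[LHS]/(nceval N%:R poly_series [::]).
by rewrite nceval_nat dot_series_nil hornerC.
Qed.

End Polynomiality.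

(** * Derivatives in the real parameter, and the theorem *)

Lemma is_cderive_cst (R : realType) (t : R) (c : R[i]) :
  is_cderive t (fun=> c) 0.
Proof. by split; exact: is_derive_cst. Qed.

(** Multiplication by a real argument acts on real and imaginary parts separately, so the real
    product rule handles each step of the induction. *)
Lemma is_cderive_horner (R : realType) (P : {poly R[i]}) (t : R) :
  is_cderive t (fun u => P.[(u%:C)%C]) P^`().[(t%:C)%C].
Proof.
elim/poly_ind: P => [|P c [dRe dIm]].
  under [fun u => _]funext do rewrite horner0.
  by rewrite deriv0 horner0; exact: is_cderive_cst.
have ReE : (fun u : R => complex.Re (P * 'X + c%:P).[(u%:C)%C]) =
    (fun u => complex.Re P.[(u%:C)%C]) * id + cst (complex.Re c).
  apply/funext => u; rewrite hornerMXaddC /=.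
  rewrite -[RHS]/(complex.Re P.[(u%:C)%C] * u + complex.Re c).
  by case: P.[_] (c) => [a b] [e d] /=; rewrite mulr0 subr0.
have ImE : (fun u : R => complex.Im (P * 'X + c%:P).[(u%:C)%C]) =
    (fun u => complex.Im P.[(u%:C)%C]) * id + cst (complex.Im c).
  apply/funext => u; rewrite hornerMXaddC /=.
  rewrite -[RHS]/(complex.Im P.[(u%:C)%C] * u + complex.Im c).
  by case: P.[_] (c) => [a b] [e d] /=; rewrite mulr0 add0r.
rewrite derivMXaddC hornerD hornerMX; split.
  rewrite ReE; apply: is_derive_eq.
  rewrite /GRing.scale /=; case: P.[_] P^`().[_] => [a b] [a' b'] /=.
  by rewrite mulr0 subr0 mulr1 addr0 mulrC.
rewrite ImE; apply: is_derive_eq.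
rewrite /GRing.scale /=; case: P.[_] P^`().[_] => [a b] [a' b'] /=.
by rewrite mulr0 add0r mulr1 addr0 mulrC.
Qed.

Theorem theorem6p3 (R : realType) (A : starAlgType R[i]) (phi : state A)
    (B : starAlgType R[i]) (psi : state B) (copy : nat -> A -> B)
    (hcopy : monotone_copies phi psi copy)
    (r : nat) (hr : (1 <= r)%N) (X : 'I_r -> A) :
  let M : R -> ncseries R[i] r := M_series psi copy X in
  let K : ncseries R[i] r := K_series psi copy X in
  let mu : R -> 'I_r -> ncseries R[i] r := mu_vec psi copy X in
  let kappa : 'I_r -> ncseries R[i] r := kappa_vec psi copy X in
  (forall t s : R, mu (t + s) = nccomp (mu t) (mu s)) /\
  (forall t : R,
    is_ncderive t M (M t * ncsubst K (fun i => ncvar R[i] i * M t)) /\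
    (forall i : 'I_r, is_ncderive t (fun u => mu u i) (nccomp kappa (mu t) i))).
Proof.
move=> M K mu kappa; pose P := poly_series psi copy X.
have ME t : M t = nceval (t%:C)%C P.
  apply/funext => -[|a w]; last by [].
  by rewrite /nceval /ncmap /P (poly_series_nil hcopy)// /horner_eval hornerC.
have KE : K = fun v => (P v)`_1.
  by apply/funext => -[|a w]; rewrite /P ?(poly_series_nil hcopy)// coefC.
have dM t : is_ncderive t M (M t * ncvsubst (M t) K).
  move=> w; rewrite ME KE -(poly_series_generator hcopy).
  under [fun u => _]funext do rewrite ME.
  exact: is_cderive_horner.
split=> [t s|t].
  apply/funext => i; rewrite /nccomp -/(ncvsubst (M s) (ncvar _ i * M t)).
  rewrite ncvsubst_varM; congr (_ * _).
  by rewrite !ME -(ncevalD hcopy) -rmorphD.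
split=> [|i]; first exact: dM.
(* The right-hand side becomes [z_i M(t) T_{M(t)} K]. Left multiplication by [z_i] only moves
   coefficients, so the equation for [M] is enough. *)
rewrite /nccomp -/(ncvsubst (M t) (ncvar _ i * K)) ncvsubst_varM.
case=> [|a w].
  rewrite ncvarM_nil; under [fun u => _]funext do rewrite /mu /mu_vec ncvarM_nil.
  exact: is_cderive_cst.
rewrite ncvarM_cons; under [fun u => _]funext do rewrite /mu /mu_vec ncvarM_cons.
case: eqP => _; last first.
  rewrite mul0r; under [fun u => _]funext do rewrite mul0r.
  exact: is_cderive_cst.
rewrite mul1r; under [fun u => _]funext do rewrite mul1r.
exact: dM.
Qed.
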